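(* Let $\mu$ be the Markov measure on $X^{\mathbb N}$ defined by an irreducible stochastic matrix $L$ (with its stationary probability vector $\boldsymbol{l}$). Suppose a transformation $g:X^{\mathbb N}\to X^{\mathbb N}$ is generated by an automaton $\mathcal A=(X,S,\pi,\lambda)$. If the automaton $\mathcal A$ is $L$-strongly connected, then for any $x\in X$ and $\mu$-almost all $\omega\in X^{\mathbb N}$, $$\lim_{n\to\infty}\frac1n\sum_{i=0}^{n-1}\chi_{xX^{\mathbb N}}(\sigma^i g(\omega))=\sum_{\substack{(s_0,x_0)\in S\times X:\\ \lambda(s_0,x_0)=x}}\boldsymbol{t}(s_0,x_0),$$ where $\boldsymbol{t}$ is the (unique) stationary probability vector of the stochastic matrix $T_{L,\mathcal A}$.
   Context: $X$ is a finite set (alphabet) with more than one element, $X^*$ the set of finite words over $X$ (including the empty word), $X^{\mathbb N}$ the set of infinite sequences over $X$ with the product topology; for $w\in X^*$, $wX^{\mathbb N}$ is the set of sequences with prefix $w$; $\chi_E$ is the characteristic function of $E$; $\sigma$ is the shift, $(\sigma(\omega))_n=\omega_{n+1}$. Markov measure: given a stochastic matrix $L=(L_{xy})_{x,y\in X}$ and a stationary probability vector $\boldsymbol{l}$ ($\boldsymbol{l}L=\boldsymbol{l}$), it is the Borel probability measure with $\mu(x_1\ldots x_nX^{\mathbb N})=\boldsymbol{l}_{x_1}L_{x_1x_2}\cdots L_{x_{n-1}x_n}$. An automaton $\mathcal A=(X,S,\pi,\lambda)$ consists of the alphabet $X$, a nonempty finite set $S$ of states, a transition function $\pi:S\times X\to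 S$ and an output function $\lambda:S\times X\to X$. These are extended to words: $\pi(s,\varnothing)=s$, $\pi(s,xw)=\pi(\pi(s,x),w)$, and $\lambda(s,\varnothing)=\varnothing$, $\lambda(s,xw)=\lambda(s,x)\,\lambda(\pi(s,x),w)$; the latter rule also defines $\lambda(s,\omega)\in X^{\mathbb N}$ for $\omega\in X^{\mathbb N}$. A transformation $g$ of $X^{\mathbb N}$ is generated by $\mathcal A$ if for some (initial) state, also denoted $g\in S$, $g(\omega)=\lambda(g,\omega)$ for all $\omega$. $\mathcal A$ is $L$-strongly connected if for any states $s,r\in S$ and any symbols $x,y\in X$ there is a word $w=w_1\ldots w_n\in X^*$ (possibly empty) such that $\pi(s,xw)=r$ and all transitions between consecutive letters of the word $xwy$ have nonzero probability, i.e. $L_{xw_1},L_{w_1w_2},\dots,L_{w_{n-1}w_n},L_{w_ny}$ are all nonzero ($L_{xy}\ne0$ if $w$ is empty). The matrix $T_{L,\mathcal A}$ has rows and columns indexed by $S\times X$, with entries $T_{(s_0,x_0)(s_1,x_1)}=L_{x_0x_1}$ if $\pi(s_0,x_0)=s_1$ and $0$ otherwise. It is stochastic. *)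

(* Defs.v *)
From HB Require Import structures.
From mathcomp Require Import all_boot all_order all_algebra.
From mathcomp Require Import all_classical all_reals all_analysis.

Set Implicit Arguments.
Unset Strict Implicit.
Unset Printing Implicit Defensive.

Import Order.TTheory GRing.Theory Num.Theory.
Import numFieldNormedType.Exports.

Local Open Scope classical_set_scope.
Local Open Scope ring_scope.

(* The space of infinite sequences over X. The cardinality proof is a parameter
   of the type because measurable types are pointed: it provides the point. *)
Definition infseq (X : finType) (X_gt1 : (1 < #|X|)%N) : Type :=
  prod_topology (fun _ : nat => discrete_topology X).

Section infseq_instances.
Variables (X : finType) (X_gt1 : (1 < #|X|)%N).

HB.instance Definition _ := Topological.copy (infseq X_gt1)
  (prod_topology (fun _ : nat => discrete_topology X)).

HB.instance Definition _ := isPointed.Build (infseq X_gt1)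
  (fun=> enum_val (Ordinal (ltnW X_gt1))).

(* Borel sigma-algebra *)
HB.instance Definition _ := Measurable.copy (infseq X_gt1)
  (g_sigma_algebraType (@open (infseq X_gt1))).

End infseq_instances.

Section sequences.
Variable X : Type.

Definition seq_shift (om : nat -> X) : nat -> X := fun n => om n.+1.

Definition cylinder (w : seq X) : set (nat -> X) :=
  [set om | mkseq om (size w) = w].

End sequences.

(* Square matrices indexed by an arbitrary finite type *)
Section matrices.
Variables (R : realType) (I : finType).
Implicit Types (L : I -> I -> R) (l : I -> R).

Definition stochastic L : Prop :=
  (forall i j, 0 <= L i j) /\ (forall i, \sum_j L i j = 1).

Definition stationary L l : Prop :=
  [/\ forall i, 0 <= l i, \sum_i l i = 1 & forall j, \sum_i l i * L i j = l j].

Fixpoint mpow L (n : nat) (i j : I) : R :=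
  if n is n'.+1 then \sum_k L i k * mpow L n' k j else (i == j)%:R.

Definition irreducible L : Prop :=
  forall i j, exists2 n : nat, (0 < n)%N & 0 < mpow L n i j.

Fixpoint path_weight L (x : I) (w : seq I) : R :=
  if w is y :: w' then L x y * path_weight L y w' else 1.

End matrices.

Definition markov_measure (R : realType) (X : finType) (X_gt1 : (1 < #|X|)%N)
    (L : X -> X -> R) (l : X -> R) (mu : probability (infseq X_gt1) R) : Prop :=
  forall (x : X) (w : seq X),
    mu (cylinder (x :: w)) = (l x * path_weight L x w)%:E.

Record automaton (X : finType) := Automaton {
  state : finType;
  state_nonempty : (0 < #|state|)%N;
  trans : state -> X -> state;
  out : state -> X -> X }.

Section automata.
Variables (R : realType) (X : finType).
Implicit Types (A : automaton X) (L : X -> X -> R).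

Definition trans_word A (s : state A) (w : seq X) : state A :=
  foldl (@trans X A) s w.

(* n-th letter of the sequence lambda(s, om), following the rule
   lambda(s, x om) = lambda(s, x) lambda(pi(s, x), om) *)
Fixpoint out_seq A (s : state A) (om : nat -> X) (n : nat) : X :=
  if n is n'.+1 then out_seq (trans s (om 0%N)) (seq_shift om) n'
  else out s (om 0%N).

Definition generated_by A (g : (nat -> X) -> (nat -> X)) : Prop :=
  exists s : state A, forall om, g om = out_seq s om.

Definition strongly_connected L A : Prop :=
  forall (s r : state A) (x y : X), exists w : seq X,
    trans_word s (x :: w) = r /\ path (fun a b => L a b != 0) x (rcons w y).

Definition T_matrix L A (p q : state A * X) : R :=
  if trans p.1 p.2 == q.1 then L p.2 q.2 else 0.

End automata.

Arguments T_matrix {R X} L A p q.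

(* Main.v *)
Require Import Defs.
From mathcomp Require Import all_boot all_order all_algebra.
From mathcomp Require Import all_classical all_reals all_analysis.
From mathcomp Require Import measurable_realfun ring lra zify.

Import Order.TTheory GRing.Theory Num.Theory.
Import numFieldNormedType.Exports.

Local Open Scope classical_set_scope.
Local Open Scope ring_scope.

(** Feed the automaton, started in a state [s], with a [mu]-random sequence
    [om], and let [Z i] be the pair formed by the state reached before reading
    the [i]-th letter and that letter. The [i]-th output letter is a function
    of [Z i], so the frequency of [x] in the output is an ergodic average
    along [Z], which is a Markov chain with transition matrix [T_matrix L A].
    Its initial law is the product of the point mass at [s] and [l], which in
    general is not stationary, so the ergodic theorem does not apply directly;
    the law of large numbers is obtained by the martingale method instead.

    Strong connectedness of the automaton says that [T := T_matrix L A] is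
    irreducible. By the maximum principle a function [h] with [T h - h]
    constant is constant; by finite dimension every function [f] can
    then be written [f = h - T h + c] (Poisson's equation,
    [poisson_solvable]). The constant [c] is a positive normalised linear
    functional of [f] that vanishes on the image of [1 - T]: it is the
    integral of [f] against the stationary vector, which proves existence and
    uniqueness of that vector at once ([unique_stationary]).

    Summing Poisson's equation along the chain gives
      [f (Z 0) + .. + f (Z (n-1)) = n c + M n + h (Z 0) - h (Z n)],
    where [M n] is a sum of [n] bounded martingale differences
    [h (Z (i+1)) - (T h) (Z i)]. Orthogonality of the differences gives
    [E (M n ^ 2) <= C ^ 2 n] ([martingale_second_moment]). Hence
    [E ((M (k^2) / k^2) ^ 2)] is summable in [k], so [M (k^2) / k^2] tends to 0
    almost surely, and the bounded increments of [M] fill the gaps between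
    consecutive squares ([slln_bounded_increments]). *)

(** * Potential theory of a finite irreducible stochastic matrix *)

Section potential.
Context {R : realType} {I : finType}.
Implicit Types (T : I -> I -> R) (f h : I -> R).

(** Maximum principle: where [h] is maximal, the average of [h] over the
    successors can only reach [h] if all successors are again maximal, and
    maximality propagates along the whole connected graph. *)
Lemma subharmonic_constant T h :
  stochastic T -> (forall p q, connect (fun a b => T a b != 0) p q) ->
  (forall p, h p <= \sum_q T p q * h q) -> forall p q, h p = h q.
Proof.
move=> [T0 T1] Tconn hT p q.
pose m := [arg max_(i > p) h i]%O.
have hm i : h i <= h m by rewrite /m; case: arg_maxP => // j _; apply.
suff hE i : h i = h m by rewrite !hE.
have /connectP[w] := Tconn m i.
have : h m = h m by [].
elim: w {1 3 4}m => [|b w IHw] a ham /=; first by move=> _ ->.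
case/andP => Tab wP; apply: (IHw b) => //.
have /eqP : T a b * (h m - h b) = 0.
  apply: (@psumr_eq0P _ _ xpredT (fun j => T a j * (h m - h j))) => //.
    by move=> j _; rewrite mulr_ge0// subr_ge0.
  apply/eqP; rewrite eq_le sumr_ge0 ?andbT; last first.
    by move=> j _; rewrite mulr_ge0// subr_ge0.
  under eq_bigr do rewrite mulrBr.
  by rewrite sumrB -mulr_suml T1 mul1r -ham subr_le0.
by rewrite mulf_eq0 (negbTE Tab) subr_eq0 => /eqP.
Qed.

(** At a minimum of [h] the term [h - T h] is nonpositive, so there [f <= c]. *)
Lemma poisson_const_ge0 T f h c (i0 : I) : stochastic T ->
  (forall p, f p = h p - \sum_q T p q * h q + c) ->
  (forall p, 0 <= f p) -> 0 <= c.
Proof.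
move=> [T0 T1] fE f0.
pose m := [arg min_(i < i0) h i]%O.
have hm i : h m <= h i by rewrite /m; case: arg_minP => // j _; apply.
apply: (le_trans (f0 m)); rewrite fE -lerBrDr subrr subr_le0.
rewrite -[leLHS]mul1r -(T1 m) mulr_suml ler_sum// => j _.
by rewrite ler_wpM2l.
Qed.

(** Positivity applied to the difference of two decompositions, in both
    orders. *)
Lemma poisson_const_unique T h1 h2 c1 c2 (i0 : I) : stochastic T ->
  (forall p, h1 p - \sum_q T p q * h1 q + c1 = h2 p - \sum_q T p q * h2 q + c2) ->
  c1 = c2.
Proof.
move=> sT E; apply/eqP; rewrite eq_le -!(subr_ge0 _ c1) -!(subr_ge0 _ c2).
have S g1 g2 p : \sum_q T p q * (g1 q - g2 q) =
   \sum_q T p q * g1 q - \sum_q T p q * g2 q.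
  by rewrite -sumrB; apply: eq_bigr => q _; rewrite mulrBr.
apply/andP; split.
- apply: (@poisson_const_ge0 T (fun=> 0) (fun p => h2 p - h1 p)) => // p.
  by rewrite S; have := E p; lra.
- apply: (@poisson_const_ge0 T (fun=> 0) (fun p => h1 p - h2 p)) => // p.
  by rewrite S; have := E p; lra.
Qed.

(** The operator [1 - T] kills the constants, so [h] may be normalised by
    [h i0 = 0], and the coordinate freed in this way can carry [c]. This makes
    [(h, c) |-> h - T h + c] a square linear system, and the maximum principle
    shows that it is injective, hence invertible. *)
Lemma poisson_solvable T (i0 : I) :
  stochastic T -> (forall p q, connect (fun a b => T a b != 0) p q) ->
  forall f, exists h c, forall p, f p = h p - \sum_q T p q * h q + c.
Proof.
move=> sT Tconn f.
(* A row vector [v] encodes the pair [(hof v, cof v)]: its [i0]-th entry is the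
   constant, the others are the values of [h] away from [i0]. *)
pose hof (v : 'rV[R]_#|I|) i := if i == i0 then 0 else v 0 (enum_rank i).
pose cof (v : 'rV[R]_#|I|) := v 0 (enum_rank i0).
pose B : 'M[R]_#|I| := \matrix_(k, j)
  if enum_val k == i0 then 1
  else (k == j)%:R - T (enum_val j) (enum_val k).
have BE v p : (v *m B) 0 (enum_rank p) =
    hof v p - \sum_q T p q * hof v q + cof v.
  rewrite mxE (reindex enum_rank) /=; last exact/onW_bij/enum_rank_bij.
  rewrite (bigD1 i0)//= mxE enum_rankK eqxx mulr1 addrC; congr (_ + _).
  rewrite [in RHS](bigD1 i0)//= /hof eqxx mulr0 add0r.
  have -> : (if p == i0 then 0 else v 0 (enum_rank p)) =
      \sum_(i | i != i0) v 0 (enum_rank i) * (i == p)%:R.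
    case: eqP => [->|/eqP p0].
      by rewrite big1// => i /negPf ->; rewrite mulr0.
    rewrite (bigD1 p)//= eqxx mulr1 big1 ?addr0// => i /andP[_ /negPf->].
    by rewrite mulr0.
  rewrite -sumrB; apply: eq_bigr => i /negPf i0F.
  rewrite mxE !enum_rankK i0F mulrBr (inj_eq enum_rank_inj).
  by rewrite [T _ _ * _]mulrC.
have Bunit : B \in unitmx.
  rewrite -row_free_unit; apply: inj_row_free => v vB0.
  have E p : hof v p - \sum_q T p q * hof v q + cof v = 0.
    by rewrite -BE vB0 mxE.
  have c0 : cof v = 0.
    apply: (@poisson_const_unique T (hof v) (fun=> 0) _ _ i0 sT) => p.
    by rewrite E big1 ?subr0 ?addr0// => q _; rewrite mulr0.
  have hcst := @subharmonic_constant T (hof v) sT Tconn.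
  apply/rowP => j; rewrite mxE -(enum_valK j).
  have [j0|j0] := eqVneq (enum_val j) i0; first by rewrite j0.
  have -> : v 0 (enum_rank (enum_val j)) = hof v (enum_val j).
    by rewrite /hof (negPf j0).
  rewrite (hcst _ _ i0) /hof ?eqxx// => p.
  by have := E p; rewrite c0 /hof; lra.
pose v := (\row_j f (enum_val j)) *m invmx B.
by exists (hof v), (cof v) => p; rewrite -BE mulmxKV// mxE enum_rankK.
Qed.

Lemma stationary_poisson_mean T t f h c : stationary T t ->
  (forall p, f p = h p - \sum_q T p q * h q + c) -> \sum_p t p * f p = c.
Proof.
move=> [_ t1 tT] fE.
under eq_bigr do rewrite fE mulrDr mulrBr.
rewrite big_split/= -mulr_suml t1 mul1r sumrB.
under [X in _ - X]eq_bigr do rewrite mulr_sumr.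
rewrite exchange_big/=.
under [X in _ - X]eq_bigr => q _.
  under eq_bigr do rewrite mulrA.
  rewrite -mulr_suml tT; over.
by rewrite subrr add0r.
Qed.

(** The constant [c] in Poisson's equation is a positive linear functional of
    the right-hand side, hence given by a vector [t] whose entries are the
    constants attached to the indicator functions. *)
Lemma unique_stationary T (i0 : I) :
  stochastic T -> (forall p q, connect (fun a b => T a b != 0) p q) ->
  exists t, unique (stationary T) t.
Proof.
move=> sT Tconn; have poisson := poisson_solvable T i0 sT Tconn.
have /choice[h] := fun j => poisson (fun p => (p == j)%:R).
move=> /choice[t htE].
have combE f p : f p = \sum_j f j * h j p -
    \sum_q T p q * (\sum_j f j * h j q) + \sum_j f j * t j.
  have {1}-> : f p = \sum_j f j * (p == j)%:R.
    rewrite (bigD1 p)//= eqxx mulr1 big1 ?addr0// => j.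
    by rewrite eq_sym => /negPf->; rewrite mulr0.
  under eq_bigr do rewrite htE mulrDr mulrBr.
  rewrite big_split sumrB /=; congr (_ - _ + _).
  under [RHS]eq_bigr do rewrite mulr_sumr.
  rewrite exchange_big/=; apply: eq_bigr => j _.
  by rewrite mulr_sumr; apply: eq_bigr => q _; rewrite mulrCA.
have meanE f g c : (forall p, f p = g p - \sum_q T p q * g q + c) ->
    \sum_j f j * t j = c.
  move=> fE.
  apply: (@poisson_const_unique T (fun p => \sum_j f j * h j p) g _ _ i0 sT) => p.
  by rewrite -fE -combE.
exists t; split; first split.
- by move=> j; apply: (poisson_const_ge0 _ _ _ _ i0 sT (htE j)) => p; rewrite ler0n.
- rewrite -(@meanE (fun=> 1) (fun=> 0) 1); first by under [RHS]eq_bigr do rewrite mul1r.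
  by move=> p; rewrite big1 ?subr0 ?add0r// => q _; rewrite mulr0.
(* With [e_j] the indicator of [j], the column [p |-> T p j] is [T e_j], that
   is, [(- e_j) - T (- e_j) + e_j]: it has the same constant [t j] as [e_j]. *)
- move=> j.
  rewrite -[RHS](@meanE (fun p => T p j) (fun p => h j p - (p == j)%:R)).
    by apply: eq_bigr => p _; rewrite mulrC.
  move=> p; under eq_bigr do rewrite mulrBr.
  rewrite sumrB [X in _ - (_ - X)](bigD1 j)//= eqxx mulr1.
  rewrite [X in _ - (_ - (_ + X))]big1 ?addr0; last by move=> q /negPf->; rewrite mulr0.
  by have := htE j p; lra.
- move=> t' st'; apply/funext => j.
  rewrite -(stationary_poisson_mean _ _ _ _ _ st' (htE j)).
  rewrite (bigD1 j)//= eqxx mulr1 big1 ?addr0// => p /negPf->.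
  by rewrite mulr0.
Qed.
End potential.

(** * A strong law from a linear second moment *)

Lemma sum_inv_sqr_le2 {R : realType} (n : nat) :
  \sum_(k < n) ((k.+1 ^ 2)%:R^-1 : R) <= 2.
Proof.
case: n => [|n]; first by rewrite big_ord0.
(* Telescoping: [1/(k+2)^2 <= 1/(k+1) - 1/(k+2)]. *)
suff : \sum_(k < n.+1) ((k.+1 ^ 2)%:R^-1 : R) <= 2 - n.+1%:R^-1.
  by move/le_trans; apply; rewrite gerBl invr_ge0.
elim: n => [|n IHn]; first by rewrite big_ord1 invr1; lra.
rewrite big_ord_recr/=; apply: (le_trans (lerD IHn (lexx _))).
have n1 : n.+1%:R^-1 * n.+1%:R = 1 :> R by rewrite mulVf// pnatr_eq0.
have n2 : n.+2%:R^-1 * n.+2%:R = 1 :> R by rewrite mulVf// pnatr_eq0.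
have a0 : 0 < n.+1%:R^-1 :> R by rewrite invr_gt0 ltr0n.
have b0 : 0 < n.+2%:R^-1 :> R by rewrite invr_gt0 ltr0n.
rewrite natrX -exprVn -(natr1 n.+1).
move: n1 n2 a0 b0; rewrite -(natr1 n.+1); move: (n.+1%:R) => x.
move: (x^-1) ((x + 1)^-1) => a b n1 n2 a0 b0.
have ab : a - b = a * b.
  have -> : a - b = a * (b * (x + 1)) - b * (a * x) by rewrite n1 n2; ring.
  by ring.
have : 0 <= b * (a - b) by rewrite ab !mulr_ge0// ltW.
nra.
Qed.

(** Between the squares [k^2] and [(k+1)^2] the sequence moves by at most
    [2 k C], which is negligible with respect to [k^2]. *)
Lemma cvg_average_squares {R : realType} (M : nat -> R) (C : R) :
  (forall n, `|M n.+1 - M n| <= C) ->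
  (k ^ 2)%:R^-1 * M (k ^ 2)%N @[k --> \oo] --> 0 ->
  n%:R^-1 * M n @[n --> \oo] --> 0.
Proof.
move=> MC /cvgr0Pnorm_lt Msq; apply/cvgr0Pnorm_le => e e0.
have C0 : 0 <= C := le_trans (normr_ge0 _) (MC 0%N).
have gap m n : `|M (m + n)%N - M m| <= C * n%:R.
  elim: n => [|n IHn]; first by rewrite addn0 subrr normr0 mulr0.
  rewrite addnS -(subrKA (M (m + n)%N)) (le_trans (ler_normD _ _))//.
  by rewrite -natr1 mulrDr mulr1 addrC lerD.
have e2 : 0 < e / 2 by rewrite divr_gt0.
have [N _ HN] := Msq _ e2.
(* Beyond [K] the values at squares are within [e/2], and the second bound
   makes [2 C k <= (e/2) k^2], which controls the oscillation in the gap. *)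
pose K := maxn N.+1 (Num.truncn (4 * C / e)).+1.
exists (K ^ 2)%N => // n /= Kn.
have [k /andP[kn nk]] : exists k, (k ^ 2 <= n < k.+1 ^ 2)%N.
  exists (Nat.sqrt n).
  have := PeanoNat.Nat.sqrt_spec n (PeanoNat.Nat.le_0_l _).
  by rewrite -!mulnn; lia.
have Kk : (K <= k)%N by rewrite -ltnS -(@ltn_exp2r _ _ 2)//; lia.
have k0 : (0 < k)%N by apply: leq_trans Kk; rewrite leq_max.
have n0 : (0 < n)%N by apply: leq_trans kn; rewrite expn_gt0 k0.
have k0R : (0 : R) < k%:R by rewrite ltr0n.
have Mk : `|M (k ^ 2)%N| <= e / 2 * (k ^ 2)%:R.
  have /ltW := HN k (leq_trans (ltnW (leq_maxl _ _)) Kk).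
  rewrite normrM ger0_norm ?invr_ge0//.
  by rewrite mulrC ler_pdivrMr// ltr0n expn_gt0 k0.
have Ck : C * (n - k ^ 2)%:R <= e / 2 * (k ^ 2)%:R.
  have nk2 : (n - k ^ 2 <= 2 * k)%N by rewrite -mulnn in nk *; lia.
  apply: (@le_trans _ _ (C * (2 * k)%:R)).
    by rewrite ler_wpM2l// ler_nat.
  have : 4 * C / e <= k%:R.
    apply: (le_trans (ltW (truncnS_gt _))).
    by rewrite ler_nat (leq_trans _ Kk)// leq_maxr.
  rewrite ler_pdivrMr// natrM natrX expr2 => Hk.
  nra.
rewrite normrM ger0_norm ?invr_ge0// mulrC ler_pdivrMr ?ltr0n//.
have := gap (k ^ 2)%N (n - k ^ 2)%N; rewrite subnKC// => g.
have kn' : (k ^ 2)%:R <= n%:R :> R by rewrite ler_nat.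
have : `|M n| <= `|M (k ^ 2)%N| + C * (n - k ^ 2)%:R.
  by rewrite -(subrK (M (k ^ 2)%N) (M n)) addrC (le_trans (ler_normD _ _))// lerD2l.
nra.
Qed.

Lemma cvg0_sqr {R : realType} (u : nat -> R) :
  u n ^+ 2 @[n --> \oo] --> 0 -> u n @[n --> \oo] --> 0.
Proof.
move=> /cvgr0Pnorm_lt u0; apply/cvgr0Pnorm_lt => e e0.
near=> n.
have : `|u n ^+ 2| < e ^+ 2 by near: n; apply: u0; rewrite exprn_gt0.
by rewrite normrX ltr_pXn2r// nnegrE// ltW.
Unshelve. all: by end_near. Qed.
(** The squares [(M (k^2) / k^2)^2] have integrals at most [V / k^2], so their
    sum over [k] is integrable, hence almost everywhere finite, and its terms
    tend to 0. Only square times are used because [1/n] is not summable. *)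
Lemma slln_bounded_increments {d} {T : measurableType d} {R : realType}
    (mu : {measure set T -> \bar R}) (M : nat -> T -> R) (C V : R) :
  (forall n, measurable_fun setT (M n)) ->
  (forall n x, `|M n.+1 x - M n x| <= C) ->
  (forall n, (\int[mu]_x (M n x ^+ 2)%:E <= (V * n%:R)%:E)%E) ->
  {ae mu, forall x, n%:R^-1 * M n x @[n --> \oo] --> 0}.
Proof.
move=> mM MC MV.
(* Squares are indexed from [k = 1] on, to stay away from a zero denominator. *)
pose u k x : R := ((k.+1 ^ 2)%:R^-1 * M (k.+1 ^ 2)%N x) ^+ 2.
have V0 : 0 <= V.
  rewrite -lee_fin -[V]mulr1 (le_trans _ (MV 1%N))// integral_ge0// => x _.
  by rewrite lee_fin sqr_ge0.
have u0 k x : (0 <= (u k x)%:E)%E by rewrite lee_fin sqr_ge0.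
have mu_ k : measurable_fun setT (fun x => (u k x)%:E).
  apply/measurable_EFinP; apply: measurable_funX.
  by apply: measurable_funM => //; exact: measurable_cst.
have uV k : (\int[mu]_x (u k x)%:E <= (V * (k.+1 ^ 2)%:R^-1)%:E)%E.
  under eq_integral do rewrite /u exprMn EFinM.
  rewrite ge0_integralZl//; last 2 first.
  - by apply/measurable_EFinP; apply: measurable_funX.
  - by move=> x _; rewrite lee_fin sqr_ge0.
  apply: (@le_trans _ _ (((k.+1 ^ 2)%:R^-1 ^+ 2)%:E * (V * (k.+1 ^ 2)%:R)%:E)%E).
    by rewrite lee_wpmul2l// lee_fin sqr_ge0.
  have k0 : (k.+1 ^ 2)%:R != 0 :> R by rewrite pnatr_eq0 expn_eq0.
  by rewrite -EFinM lee_fin expr2 mulrCA -!mulrA mulVf// mulr1.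
have usum : (\int[mu]_x (\sum_(0 <= k <oo) (u k x)%:E) < +oo)%E.
  rewrite integral_nneseries//.
  apply: (@le_lt_trans _ _ (V * 2)%:E); last exact: ltry.
  apply: lime_le.
    by apply: is_cvg_nneseries => k _ _; exact: integral_ge0.
  apply: nearW => n; rewrite big_mkord.
  apply: (@le_trans _ _ (\sum_(k < n) (V * (k.+1 ^ 2)%:R^-1)%:E)%E).
    by apply: lee_sum.
  by rewrite sumEFin lee_fin -mulr_sumr ler_wpM2l// sum_inv_sqr_le2.
have : mu.-integrable setT (fun x => \sum_(0 <= k <oo) (u k x)%:E)%E.
  apply/integrableP; split; first exact: ge0_emeasurable_sum.
  by under eq_integral do rewrite gee0_abs ?nneseries_ge0//.
move=> /integrable_ae-/(_ measurableT); apply: filterS => x /(_ I) ufin.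
apply: (cvg_average_squares (fun n => M n x) C) => //.
rewrite -cvg_shiftS; apply: cvg0_sqr.
apply: cvg_series_cvg_0; apply: nnseries_is_cvg.
  by move=> k; rewrite sqr_ge0.
by rewrite ltey_eq ufin.
Qed.

(** * Functions of finitely many letters under a Markov measure *)

Lemma big_tuple_cons {R : realType} {X : finType} (n : nat) (F : seq X -> R) :
  \sum_(w : n.+1.-tuple X) F w = \sum_y \sum_(w : n.-tuple X) F (y :: w).
Proof.
rewrite pair_big/= (reindex (fun p : X * n.-tuple X => [tuple of p.1 :: p.2]))//=.
exists (fun w : n.+1.-tuple X => (thead w, [tuple of behead w])).
  by move=> [y w] _ /=; congr pair; apply: val_inj.
by move=> w _; rewrite [w in RHS]tuple_eta; apply: val_inj.
Qed.

Lemma big_tuple0 {R : realType} {X : finType} (F : seq X -> R) :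
  \sum_(w : 0.-tuple X) F w = F [::].
Proof.
rewrite (bigD1 [tuple])//= big1 ?addr0// => w.
by rewrite (tuple0 w) => /eqP.
Qed.

(** Cylinders are finite intersections of preimages of points under the
    coordinates, which are continuous into a discrete space. *)
Lemma measurable_cylinder {X : finType} (X_gt1 : (1 < #|X|)%N) (w : seq X) :
  measurable (cylinder w : set (infseq X_gt1)).
Proof.
have mletter (i : nat) (x : X) :
    measurable ([set om | om i = x] : set (infseq X_gt1)).
  apply: sub_sigma_algebra.
  apply: (@open_comp _ _
    (fun om : prod_topology (fun _ : nat => discrete_topology X) => om i)
    [set x]).
    by move=> om _; exact: proj_continuous.
  exact: discrete_open.
case: w => [|x0 w].
  rewrite (_ : cylinder _ = setT); first exact: measurableT.
  by apply/seteqP; split.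
rewrite (_ : cylinder _ =
  \bigcap_(i in `I_(size (x0 :: w))) [set om | om i = nth x0 (x0 :: w) i]).
  by apply: bigcap_measurable => [|i _]; [exists 0%N|exact: mletter].
apply/seteqP; split => [om omw i ilt|om omw]; rewrite /cylinder/=.
  by rewrite -[in RHS]omw nth_mkseq.
apply: (@eq_from_nth _ x0 (mkseq om _)); rewrite size_mkseq// => i ilt.
by rewrite nth_mkseq// omw.
Qed.

Section finite_prefix.
Context {R : realType} {X : finType} {X_gt1 : (1 < #|X|)%N}.

(** The cylinders over the words of length [n] partition the sequences; this
    turns integrals of functions of the first [n] letters into finite sums. *)
Lemma prefix_fun_sum (n : nat) (F : seq X -> R) (om : nat -> X) :
  F (mkseq om n) = \sum_(w : n.-tuple X) F w * \1_(cylinder w) om.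
Proof.
pose w0 := Tuple (introT eqP (size_mkseq om n)).
rewrite (bigD1 w0)//= indicE mem_set ?mulr1; last first.
  by rewrite /cylinder /= size_mkseq.
rewrite big1 ?addr0// => w ww0; rewrite indicE memNset ?mulr0//.
rewrite /cylinder/= size_tuple => e; case/eqP: ww0.
by apply: val_inj; rewrite /= e.
Qed.

Lemma measurable_prefix_fun (n : nat) (F : seq X -> R) :
  measurable_fun setT (fun om : infseq X_gt1 => F (mkseq om n)).
Proof.
under eq_fun do rewrite prefix_fun_sum.
apply: measurable_sum => w; apply: measurable_funM.
  exact: measurable_cst.
by apply: measurable_indic; exact: measurable_cylinder.
Qed.

Lemma integral_prefix_fun (L : X -> X -> R) (l : X -> R)
    (mu : probability (infseq X_gt1) R) (n : nat) (F : seq X -> R) :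
  markov_measure L l mu -> (forall w, 0 <= F w) ->
  (\int[mu]_om (F (mkseq om n.+1))%:E =
   (\sum_x l x * \sum_(w : n.-tuple X) path_weight L x w * F (x :: w))%:E)%E.
Proof.
move=> muL F0.
have F1 (w : n.+1.-tuple X) (om : infseq X_gt1) : (0 <= (\1_(cylinder w) om : R)%:E)%E.
  by rewrite lee_fin.
under eq_integral do rewrite prefix_fun_sum -sumEFin.
rewrite ge0_integral_sum//=; last 2 first.
- move=> w; apply/measurable_EFinP; apply: measurable_funM.
    exact: measurable_cst.
  by apply: measurable_indic; exact: measurable_cylinder.
- by move=> w om _; rewrite lee_fin mulr_ge0.
have intE (w : n.+1.-tuple X) : (\int[mu]_om (F w * \1_(cylinder w) om)%:E =
   (F w)%:E * mu (cylinder w))%E.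
  under eq_integral do rewrite EFinM.
  rewrite ge0_integralZl//.
  - by rewrite integral_indic ?setIT//; exact: measurable_cylinder.
  - apply/measurable_EFinP; apply: measurable_indic; exact: measurable_cylinder.
  - by rewrite lee_fin.
pose W (w : seq X) : R := if w is x :: w' then l x * path_weight L x w' else 1.
transitivity (\sum_(w : n.+1.-tuple X) (F w * W w)%:E)%E.
  apply: eq_bigr => w _; rewrite intE EFinM; congr (_ * _)%E.
  by case/tupleP: w => x w; exact: muL.
rewrite sumEFin (big_tuple_cons n (fun w => F w * W w)).
congr EFin; apply: eq_bigr => x _.
by rewrite mulr_sumr; apply: eq_bigr => w _ /=; ring.
Qed.
End finite_prefix.

(** * The chain of states and letters *)

Section joint_chain.
Context {R : realType} {X : finType} (A : automaton X) (L : X -> X -> R).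
Implicit Types (p q : state A * X) (h : state A * X -> R).

Lemma sum_T_matrix h p :
  \sum_q T_matrix L A p q * h q = \sum_y L p.2 y * h (trans p.1 p.2, y).
Proof.
rewrite [LHS](eq_bigr (fun q => T_matrix L A p (q.1, q.2) * h (q.1, q.2)));
  last by move=> [].
rewrite -(pair_big xpredT xpredT (fun s y => T_matrix L A p (s, y) * h (s, y)))/=.
rewrite (bigD1 (trans p.1 p.2))//= [X in _ + X]big1 ?addr0.
  by apply: eq_bigr => y _; rewrite /T_matrix eqxx.
move=> s /negPf sF; rewrite big1// => y _.
by rewrite /T_matrix eq_sym/= sF mul0r.
Qed.

Lemma stochastic_T_matrix : stochastic L -> stochastic (T_matrix L A).
Proof.
move=> [L0 L1]; split=> [p q|p]; first by rewrite /T_matrix; case: ifP.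
have := sum_T_matrix (fun=> 1) p.
by under eq_bigr do rewrite mulr1; under [RHS]eq_bigr do rewrite mulr1; rewrite L1.
Qed.

(** A word witnessing strong connectedness is exactly an itinerary of the
    second components of the chain; its first components are forced. *)
Lemma connect_T_matrix : strongly_connected L A ->
  forall p q, connect (fun a b => T_matrix L A a b != 0) p q.
Proof.
move=> scA p q.
have [w []] := scA p.1 q.1 p.2 q.2.
elim: w p => [|y w IHw] p /= tE.
  by rewrite andbT => Lpq; apply: connect1; rewrite /T_matrix tE eqxx.
case/andP => Lpy wP; apply: (@connect_trans _ _ (trans p.1 p.2, y)).
  by apply: connect1; rewrite /T_matrix eqxx.
exact: IHw.
Qed.

Fixpoint joint_chain (s : state A) (om : nat -> X) (n : nat) : state A * X :=
  if n is m.+1 then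
    let p := joint_chain s om m in (trans p.1 p.2, om n)
  else (s, om 0%N).

Lemma joint_chain_shift s om n :
  joint_chain s om n.+1 = joint_chain (trans s (om 0%N)) (seq_shift om) n.
Proof. by elim: n => //= n <-. Qed.

Lemma out_seq_joint_chain s om n :
  out_seq s om n = out (joint_chain s om n).1 (joint_chain s om n).2.
Proof.
elim: n s om => [//|n IHn] s om.
by rewrite joint_chain_shift -IHn.
Qed.

(** The deviation of [h] at the next position [q] from its conditional mean
    given the present position [p]. *)
Definition increment h p q : R := h q - \sum_r T_matrix L A p r * h r.

(** Recursion from the front of the word makes the second moment an induction
    in which conditioning on the first letter read leaves an instance of the
    same sum, started at the next position. *)
Fixpoint martingale h p (w : seq X) : R :=
  if w is y :: w' then
    let q := (trans p.1 p.2, y) in increment h p q + martingale h q w'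
  else 0.

Lemma martingale_joint_chain h s om n :
  martingale h (s, om 0%N) (mkseq (seq_shift om) n) =
  \sum_(i < n) increment h (joint_chain s om i) (joint_chain s om i.+1).
Proof.
elim: n s om => [|n IHn] s om; first by rewrite big_ord0.
rewrite big_ord_recl -[mkseq _ _]/(_ :: map _ (iota 1 n)) -[1%N]addn0 iotaDl -map_comp.
have -> : [seq (seq_shift om \o addn 1) i | i <- iota 0 n] =
          mkseq (seq_shift (seq_shift om)) n by [].
rewrite /= (IHn (trans s (om 0%N)) (seq_shift om)); congr (_ + _).
by apply: eq_bigr => i _; rewrite -!joint_chain_shift.
Qed.

Lemma increment_mean h p : stochastic L ->
  \sum_y L p.2 y * increment h p (trans p.1 p.2, y) = 0.
Proof.
move=> [_ L1]; under eq_bigr do rewrite mulrBr.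
by rewrite sumrB -sum_T_matrix -mulr_suml L1 mul1r subrr.
Qed.

(** The induction on [n] conditions on the first letter read, which shifts the
    starting value [a] by a deviation of mean zero; this is why [a] has to be
    arbitrary. The cross term vanishes by [increment_mean] and each letter
    contributes at most [C ^ 2]. *)
Lemma martingale_second_moment h C n p (a : R) : stochastic L ->
  (forall p q, `|increment h p q| <= C) ->
  \sum_(w : n.-tuple X) path_weight L p.2 w * (a + martingale h p w) ^+ 2 <=
  a ^+ 2 + C ^+ 2 * n%:R.
Proof.
move=> sL hC; have [L0 L1] := sL.
elim: n p a => [|n IHn] p a.
  rewrite (big_tuple0 (fun w => path_weight L p.2 w * (a + martingale h p w) ^+ 2)).
  by rewrite /= mul1r addr0 mulr0 addr0.
rewrite (big_tuple_cons n (fun w => path_weight L p.2 w * (a + martingale h p w) ^+ 2)) /=.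
pose D y := increment h p (trans p.1 p.2, y).
apply: (@le_trans _ _ (\sum_y L p.2 y * ((a + D y) ^+ 2 + C ^+ 2 * n%:R))).
  apply: ler_sum => y _.
  apply: le_trans (ler_wpM2l (L0 _ _) (IHn (trans p.1 p.2, y) (a + D y))).
  rewrite mulr_sumr ler_sum// => w _ /=.
  by rewrite -mulrA addrA.
have -> : \sum_y L p.2 y * ((a + D y) ^+ 2 + C ^+ 2 * n%:R) =
    a ^+ 2 + \sum_y L p.2 y * D y ^+ 2 + C ^+ 2 * n%:R.
  transitivity (\sum_y (L p.2 y * (a ^+ 2 + C ^+ 2 * n%:R) +
     (L p.2 y * D y) * (2 * a) + L p.2 y * D y ^+ 2)).
    by apply: eq_bigr => y _; ring.
  rewrite !big_split/= -!mulr_suml L1 increment_mean//; ring.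
rewrite -natr1 mulrDr mulr1 -addrA lerD2l addrC lerD2l.
rewrite -[leRHS]mul1r -(L1 p.2) mulr_suml ler_sum// => y _.
rewrite ler_wpM2l//; move: (hC p (trans p.1 p.2, y)).
by rewrite ler_norml => /andP[]; rewrite /D; nra.
Qed.
End joint_chain.

Lemma fin_fun_bounded {R : realType} {I : finType} (f : I -> R) :
  exists C, forall i, `|f i| <= C.
Proof.
exists (\sum_i `|f i|) => i.
by rewrite (bigD1 i)//= lerDl sumr_ge0.
Qed.

(** * The law of large numbers and the theorem *)

Lemma cvg_average_bounded {R : realType} (u : nat -> R) (C : R) :
  (forall n, `|u n| <= C) -> n%:R^-1 * u n @[n --> \oo] --> 0.
Proof.
move=> uC; have inv0 : (n%:R^-1 : R) @[n --> \oo] --> 0.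
  by rewrite -cvg_shiftS; exact: cvg_harmonic.
apply: (@squeeze_cvgr _ _ _ _ (fun n => - (n%:R^-1 * C)) (fun n => n%:R^-1 * C)).
- apply: nearW => n; rewrite -ler_norml normrM ger0_norm ?invr_ge0//.
  by rewrite ler_wpM2l// invr_ge0.
- by rewrite -oppr0; apply: cvgN; rewrite -[0](mul0r C); exact: cvgMl.
- by rewrite -[0](mul0r C); exact: cvgMl.
Qed.

(** Poisson's equation reduces the average of [f] to [c], a martingale average
    and a bounded boundary term. The initial state is arbitrary: [l] only
    governs the first letter. *)
Lemma joint_chain_lln {R : realType} {X : finType} {X_gt1 : (1 < #|X|)%N}
    (L : X -> X -> R) (l : X -> R) (mu : probability (infseq X_gt1) R)
    (A : automaton X) (t : state A * X -> R) (s : state A)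
    (f : state A * X -> R) :
  stochastic L -> stationary L l -> markov_measure L l mu ->
  strongly_connected L A -> stationary (T_matrix L A) t ->
  {ae mu, forall om : infseq X_gt1,
    n%:R^-1 * \sum_(i < n) f (joint_chain A s om i) @[n --> \oo]
      --> \sum_p t p * f p}.
Proof.
move=> sL [l0 l1 _] muL scA tP.
have sT : stochastic (T_matrix L A) := stochastic_T_matrix _ _ sL.
have Tconn := connect_T_matrix A L scA.
pose p0 : state A * X := (s, enum_val (Ordinal (ltnW X_gt1))).
have [h [c fE]] := poisson_solvable _ p0 sT Tconn f.
rewrite (stationary_poisson_mean _ _ _ _ _ tP fE).
pose Z om i := joint_chain A s om i.
pose M n om := \sum_(i < n) increment A L h (Z om i) (Z om i.+1).
have [H hH] := fin_fun_bounded h.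
have [C incC] := fin_fun_bounded (fun pq => increment A L h pq.1 pq.2).
pose F (w : seq X) := if w is x :: w' then martingale A L h (s, x) w' else 0.
(* [M n] depends on the first [n + 1] letters, as its last increment involves
   the letter number [n]. *)
have MF n om : M n om = F (mkseq om n.+1).
  rewrite /M -martingale_joint_chain /=; congr martingale.
  by rewrite -[1%N]addn0 iotaDl -map_comp.
have mM n : measurable_fun setT (M n : infseq X_gt1 -> R).
  rewrite (_ : M n = fun om : infseq X_gt1 => F (mkseq om n.+1)).
    exact: measurable_prefix_fun.
  by apply/funext => om; exact: MF.
have M2 n : (\int[mu]_om (M n om ^+ 2)%:E <= (C ^+ 2 * n%:R)%:E)%E.
  under eq_integral do rewrite MF.
  rewrite (integral_prefix_fun L l mu n (fun w => F w ^+ 2) muL); last first.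
    by move=> w; rewrite sqr_ge0.
  rewrite lee_fin -[leRHS]mul1r -[X in X * _]l1 mulr_suml ler_sum// => x _.
  rewrite ler_wpM2l//.
  have := martingale_second_moment A L h C n (s, x) 0 sL (fun p q => incC (p, q)).
  rewrite expr0n add0r => M2x; apply: le_trans M2x.
  by apply: ler_sum => w _; rewrite add0r.
have Minc n om : `|M n.+1 om - M n om| <= C.
  rewrite /M big_ord_recr/= addrAC subrr add0r; exact: (incC (_, _)).
have := slln_bounded_increments mu M C (C ^+ 2) mM Minc M2.
apply: filterS => om Mom.
have bdry := cvg_average_bounded (fun n => h (Z om 0%N) - h (Z om n)) (H + H)
  (fun n => le_trans (ler_normB _ _) (lerD (hH _) (hH _))).
have sumE n : \sum_(i < n) f (Z om i) =
    M n om + (h (Z om 0%N) - h (Z om n)) + n%:R * c.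
  elim: n => [|n IHn].
    by rewrite big_ord0 /M big_ord0 subrr mul0r !addr0.
  rewrite big_ord_recr/= IHn /M big_ord_recr/= /increment (fE (Z om n)) -natr1.
  ring.
apply: (@cvg_trans _ ((n%:R^-1 * M n om +
    n%:R^-1 * (h (Z om 0%N) - h (Z om n)) + c) @[n --> \oo])).
  apply: near_eq_cvg; near=> n.
  rewrite sumE -mulrDr [in RHS]mulrDr mulKf// pnatr_eq0 -lt0n.
  by near: n; exact: nbhs_infty_gt.
have cstc : (fun=> c) @ \oo --> c by exact: cvg_cst.
have := cvgD (cvgD Mom bdry) cstc; rewrite !add0r => lim; exact: lim.
Unshelve. all: by end_near. Qed.

Theorem theorem4p7 (R : realType) (X : finType) (X_gt1 : (1 < #|X|)%N)
    (L : X -> X -> R) (l : X -> R) (mu : probability (infseq X_gt1) R)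
    (A : automaton X) (g : infseq X_gt1 -> infseq X_gt1) :
  stochastic L -> irreducible L -> stationary L l ->
  markov_measure L l mu ->
  generated_by A g ->
  strongly_connected L A ->
  exists t : state A * X -> R,
    unique (stationary (T_matrix L A)) t /\
    forall x : X, {ae mu, forall om : infseq X_gt1,
      (fun n : nat =>
         n%:R^-1 * \sum_(i < n) \1_(cylinder [:: x]) (iter i (@seq_shift X) (g om)))
        @ \oo --> \sum_(p : state A * X | out p.1 p.2 == x) t p}.
Proof.
move=> sL _ sl muL [s gE] scA.
pose p0 : state A * X := (s, enum_val (Ordinal (ltnW X_gt1))).
have [t tP] := unique_stationary (T_matrix L A) p0
  (stochastic_T_matrix _ _ sL) (connect_T_matrix A L scA).
exists t; split=> // x.
have := joint_chain_lln L l mu A t s (fun p => (out p.1 p.2 == x)%:R)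
  sL sl muL scA tP.1.
have -> : \sum_p t p * (out p.1 p.2 == x)%:R =
          \sum_(p : state A * X | out p.1 p.2 == x) t p.
  by rewrite [RHS]big_mkcond; apply: eq_bigr => p _; case: eqP; rewrite ?mulr1 ?mulr0.
apply: filterS => om.
suff -> : (fun n : nat => n%:R^-1 * \sum_(i < n) (out (joint_chain A s om i).1
      (joint_chain A s om i).2 == x)%:R) =
    (fun n : nat => n%:R^-1 * \sum_(i < n)
      \1_(cylinder [:: x]) (iter i (@seq_shift X) (g om)) : R) by [].
apply/funext => n; congr (_ * _); apply: eq_bigr => i _.
rewrite gE -out_seq_joint_chain indicE; congr (nat_of_bool _)%:R.
have iterE (v : nat -> X) : iter i (@seq_shift X) v 0%N = v i.
  by elim: (i : nat) v => //= j IH v; rewrite -iterS iterSr IH.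
rewrite -[in LHS]iterE.
apply/eqP/idP => [e|]; first by rewrite inE /cylinder/= /mkseq/= e.
by rewrite inE /cylinder/= /mkseq/= => -[].
Qed.
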